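(* Let $G$ be a virtually abelian group and let $S$ be a finite weighted monoid generating set of $G$. Then the language of geodesics $\{\sigma\in S^*\mid \sigma\text{ is a geodesic}\}$ of $G$ with respect to $S$ is a blind multicounter language.
   Context: A finite weighted monoid generating set of a group $G$ is a finite set $S$ generating $G$ as a monoid, where each $s\in S$ has a weight $\omega(s)\in\mathbb{N}_+=\{1,2,3,\ldots\}$. $S^*$ is the set of words in the letters of $S$; $\overline{\sigma}\in G$ is the element represented by $\sigma\in S^*$; the weight of $\sigma=\sigma_1\cdots\sigma_k$ is $\omega(\sigma)=\omega(\sigma_1)+\cdots+\omega(\sigma_k)$. A word $\sigma\in S^*$ is a geodesic if $\omega(\sigma)=\min\{\omega(\sigma')\mid \sigma'\in S^*,\ \overline{\sigma'}=\overline{\sigma}\}$. For $k\in\mathbb{N}=\{0,1,2,\ldots\}$, a blind $k$-counter automaton is a tuple $M=(Q,\Sigma,\delta,q_0,F,\mathfrak{e})$ where $Q$ is a finite set of states, $\Sigma$ is a finite input alphabet, $\delta$ is a finite subset of $\big(Q\times(\Sigma\cup\{\varepsilon,\mathfrak{e}\})\big)\times\big(Q\times\mathbb{Z}^k\big)$, $q_0\in Q$ is the initial state, $F\subseteq Q$ is the set of final states, and $\mathfrak{e}\notin\Sigma$ is the end of tape symbol ($\varepsilon$ is the empty word). A configuration is a triple $(q,c,\sigma\mathfrak{e})\in Q\times\mathbb{Z}^k\times\Sigma^*\mathfrak{e}$. For each $((q,s),(p,v))\in\delta$ with $s\in\Sigma\cup\{\varepsilon\}$, each $c\in\mathbb{Z}^k$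 and each $\sigma=s\sigma'\in\Sigma^*$, there is a transition $(q,c,\sigma\mathfrak{e})\vdash(p,c+v,\sigma'\mathfrak{e})$; for each $((q,\mathfrak{e}),(p,v))\in\delta$ and $c\in\mathbb{Z}^k$ there is a transition $(q,c,\mathfrak{e})\vdash(p,c+v,\mathfrak{e})$ (the symbol $\mathfrak{e}$ is not consumed). Let $\vdash^*$ be the reflexive transitive closure of $\vdash$. The language of $M$ is $L(M)=\{\sigma\in\Sigma^*\mid (q_0,\mathbf{0},\sigma\mathfrak{e})\vdash^*(q,\mathbf{0},\mathfrak{e})\text{ for some }q\in F\}$. A language is blind multicounter if it equals $L(M)$ for some blind $k$-counter automaton $M$ and some $k\in\mathbb{N}$. *)

(* Defs.v *)
From HB Require Import structures.
From Stdlib Require Import Relation_Operators.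
From mathcomp Require Import all_boot all_algebra.
From mathcomp Require Import finmap.

Set Implicit Arguments.
Unset Strict Implicit.
Unset Printing Implicit Defensive.

Local Open Scope group_scope.
Local Open Scope fset_scope.

(* The finite index of H is expressed by a finite list T of elements of G
   whose left cosets t H cover G. *)
Definition virtually_abelian (G : groupType) : Prop :=
  exists H : {pred G},
    [/\ group_closed H,
        {in H &, forall x y, commute x y}
      & exists T : seq G, forall g, exists2 t, t \in T & t^-1 * g \in H].

Section Geodesics.

Variables (G : groupType) (S : {fset G}) (omega : S -> nat).
Implicit Type w : seq S.

Definition word_val w : G := \prod_(s <- w) val s.

Definition generates_as_monoid : Prop :=
  forall g : G, exists w : seq S, word_val w = g.

Definition word_weight w : nat := \sum_(s <- w) omega s.

Definition is_min (A : nat -> Prop) (m : nat) : Prop :=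
  A m /\ forall n, A n -> m <= n.

Definition geodesic w : Prop :=
  is_min (fun n => exists2 w', word_val w' = word_val w & word_weight w' = n)
         (word_weight w).

End Geodesics.

Inductive label (Sigma : Type) : Type :=
  | Letter of Sigma
  | Epsilon
  | EndOfTape.
Arguments Epsilon {Sigma}.
Arguments EndOfTape {Sigma}.

(* Labels need a choiceType structure for finite sets of transitions. *)
Definition label_code (Sigma : Type) (l : label Sigma) : option (option Sigma) :=
  match l with
  | Letter s => Some (Some s)
  | Epsilon => Some None
  | EndOfTape => None
  end.

Definition label_decode (Sigma : Type) (o : option (option Sigma)) : label Sigma :=
  match o with
  | Some (Some s) => Letter s
  | Some None => Epsilon
  | None => EndOfTape
  end.

Lemma label_codeK (Sigma : Type) :
  cancel (@label_code Sigma) (@label_decode Sigma).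
Proof. by case. Qed.

HB.instance Definition _ (Sigma : choiceType) :=
  Choice.copy (label Sigma) (can_type (@label_codeK Sigma)).

(* The end of tape symbol is a constructor of [label], hence never a letter. *)
Record blind_counter_automaton (k : nat) (Sigma : finType) := BlindCounterAutomaton {
  bca_state : finType;
  bca_delta : {fset (bca_state * label Sigma) * (bca_state * 'rV[int]_k)};
  bca_init : bca_state;
  bca_final : {set bca_state}
}.

Section Language.

Variables (k : nat) (Sigma : finType) (M : blind_counter_automaton k Sigma).

(* The word component omits the end of tape symbol that terminates every
   tape: (q, c, w) stands for the configuration whose tape is w followed by
   that symbol. *)
Definition bca_config : Type := bca_state M * 'rV[int]_k * seq Sigma.

Inductive bca_step : bca_config -> bca_config -> Prop :=
  | step_letter q p s v c w :
      ((q, Letter s), (p, v)) \in bca_delta M ->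
      bca_step (q, c, s :: w) (p, (c + v)%R, w)
  | step_epsilon q p v c w :
      ((q, Epsilon), (p, v)) \in bca_delta M ->
      bca_step (q, c, w) (p, (c + v)%R, w)
  | step_end q p v c :
      ((q, EndOfTape), (p, v)) \in bca_delta M ->
      bca_step (q, c, [::]) (p, (c + v)%R, [::]).

Definition bca_language (w : seq Sigma) : Prop :=
  exists2 q, q \in bca_final M &
    clos_refl_trans _ bca_step (bca_init M, 0%R, w) (q, 0%R, [::]).

End Language.

Arguments bca_step {k Sigma} M _ _.

Definition blind_multicounter (Sigma : finType) (L : seq Sigma -> Prop) : Prop :=
  exists (k : nat) (M : blind_counter_automaton k Sigma),
    forall w, L w <-> bca_language M w.

(* Main.v *)
Require Import Defs.
From Stdlib Require Import Classical_Prop Relation_Operators.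
From mathcomp Require Import all_boot all_algebra.
From mathcomp Require Import finmap zify.

(* Let H be an abelian subgroup of finite index.  A word w is a path in the
   finite graph of right cosets of H; since H is abelian, the value and the
   weight of w depend only on the end of this path and on the vector n of its
   edge counts.  The counts of all paths with a given end form a finite union of
   linear sets b + N C (a short path b together with short loops based at its
   vertices), so w is geodesic iff n is at least as light as every m in b + N C
   with the same value, for each of these finitely many linear sets.

   This universal condition is semilinear.  Fix b and C and consider triples
   k = (x, y, z) such that n + z and b + C x + y have the same value.  Such triples
   always exist, and those minimizing first |y| + |z| and then the weight of
   C x + y have y = z = 0 iff b + N C has an element with the value of n.
   Minimality does not depend on n and is inherited by smaller triples, so by
   Dickson's lemma the minimal triples form a semilinear set; the condition on n
   becomes the existence of a minimal k with (y, z) <> 0 or with b + C x not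
   lighter than n.  A blind counter automaton counts the edges and, at the end of
   the tape, subtracts an element of the semilinear set. *)

(** * Semilinear sets *)

Section Semilinear.

Set Implicit Arguments.
Unset Strict Implicit.
Import GRing.Theory.
Local Open Scope ring_scope.

(** Coefficients are encoded by repetitions in [s], which suits structural induction; [linear_setE]
    gives the form with explicit multiplicities. *)
Definition linear_set (V : nmodType) (b : V) (C : seq V) (v : V) : Prop :=
  exists2 s, {subset s <= C} & v = b + \sum_(c <- s) c.

Definition semilinear (V : nmodType) (A : V -> Prop) : Prop :=
  exists l : seq (V * seq V),
    forall v, A v <-> exists2 p, p \in l & linear_set p.1 p.2 v.

Lemma semilinear_ext (V : nmodType) (A B : V -> Prop) :
  (forall v, A v <-> B v) -> semilinear A -> semilinear B.
Proof. by move=> AB [l lP]; exists l => v; rewrite -AB. Qed.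

Lemma semilinear_empty (V : nmodType) : semilinear (fun _ : V => False).
Proof. by exists [::] => v; split=> // -[]. Qed.

Lemma semilinear_union (V : nmodType) (A B : V -> Prop) :
  semilinear A -> semilinear B -> semilinear (fun v => A v \/ B v).
Proof.
move=> [l lP] [m mP]; exists (l ++ m) => v; rewrite lP mP; split.
  by case=> -[p p_in pv]; exists p; rewrite // mem_cat p_in ?orbT.
by case=> p; rewrite mem_cat => /orP[]; [left | right]; exists p.
Qed.

Lemma semilinear_bigunion (V : nmodType) (J : eqType) (r : seq J)
    (A : J -> V -> Prop) :
  (forall j, j \in r -> semilinear (A j)) ->
  semilinear (fun v => exists2 j, j \in r & A j v).
Proof.
elim: r => [|i r IHr] slA.
  by apply: semilinear_ext (semilinear_empty V) => v; split=> // -[].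
have slA' j : j \in r -> semilinear (A j).
  by move=> jr; apply: slA; rewrite inE jr orbT.
apply: semilinear_ext (semilinear_union (slA i (mem_head _ _)) (IHr slA')) => v.
split=> [[Av|[j jr Av]]|[j]].
- by exists i; rewrite ?mem_head.
- by exists j; rewrite // inE jr orbT.
by rewrite inE => /orP[/eqP->|jr Av]; [left | right; exists j].
Qed.

Lemma semilinear_image (V W : nmodType) (f : V -> W) (b : W) (A : V -> Prop) :
  f 0 = 0 -> {morph f : u v / u + v} ->
  semilinear A -> semilinear (fun w => exists2 v, A v & w = b + f v).
Proof.
move=> f0 fD [l lP]; exists [seq (b + f p.1, map f p.2) | p <- l] => w.
split=> [[v /lP[p p_l [s sC ->]] ->]|[_ /mapP[p p_l ->]] /= [s sC ->]].
  exists (b + f p.1, map f p.2); first by apply: map_f.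
  exists (map f s) => /=; last by rewrite fD addrA big_map (big_morph f fD f0).
  by move=> _ /mapP[c cs ->]; rewrite map_f ?sC.
(* A list of images of generators is lifted to a list of generators. *)
have [t tC ->]: exists2 t, {subset t <= p.2} & s = map f t.
  elim: s sC => [|c s IHs] sC; first by exists [::].
  have [|t tC ->] := IHs; first by move=> x xs; rewrite sC // inE xs orbT.
  have /mapP[d dC ->] := sC c (mem_head _ _).
  by exists (d :: t) => // x; rewrite inE => /orP[/eqP->|/tC].
exists (p.1 + \sum_(c <- t) c).
  by apply/lP; exists p => //; exists t.
by rewrite fD addrA big_map (big_morph f fD f0).
Qed.

Lemma pair_addE (V W : nmodType) (a c : V) (b d : W) :
  (a, b) + (c, d) = (a + c, b + d).
Proof. by []. Qed.

(** Generators of either factor are padded with a zero in the other, so a list of padded generators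
    separates into two independent lists. *)
Lemma semilinear_prod (V W : nmodType) (A : V -> Prop) (B : W -> Prop) :
  semilinear A -> semilinear B ->
  semilinear (fun z : V * W => A z.1 /\ B z.2).
Proof.
move=> [l lP] [m mP].
pose inj1 (c : V) : V * W := (c, 0); pose inj2 (d : W) : V * W := (0, d).
have sum1 s : \sum_(c <- s) inj1 c = inj1 (\sum_(c <- s) c).
  by elim: s => [|c s IHs]; rewrite ?big_nil // !big_cons IHs /inj1 pair_addE addr0.
have sum2 s : \sum_(c <- s) inj2 c = inj2 (\sum_(c <- s) c).
  by elim: s => [|c s IHs]; rewrite ?big_nil // !big_cons IHs /inj2 pair_addE addr0.
exists [seq ((p.1, q.1), map inj1 p.2 ++ map inj2 q.2) | p <- l, q <- m].
case=> v w /=; split=> [[/lP[p pl [s sC vE]] /mP[q qm [t tC wE]]]|].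
  exists ((p.1, q.1), map inj1 p.2 ++ map inj2 q.2).
    by apply/allpairsP; exists (p, q).
  exists (map inj1 s ++ map inj2 t) => /=.
    move=> x; rewrite !mem_cat => /orP[]/mapP[c c_in ->]; apply/orP.
      by left; rewrite map_f ?sC.
    by right; rewrite map_f ?tC.
  by rewrite big_cat !big_map sum1 sum2 /= !pair_addE addr0 add0r vE wE.
case=> _ /allpairsP[[p q] /= [pl qm ->]] [s]; rewrite /fst /snd => sC vwE.
suff [t [u [tC uC sE]]]: exists t u, [/\ {subset t <= p.2}, {subset u <= q.2}
    & \sum_(c <- s) c = (\sum_(c <- t) c, \sum_(d <- u) d)].
  have [-> ->] := etrans vwE (congr1 (fun z => (p.1, q.1) + z) sE).
  by split; [apply/lP; exists p => //; exists t | apply/mP; exists q => //; exists u].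
elim: s {vwE} sC => [|c s IHs] sC.
  by exists [::], [::]; rewrite !big_nil.
have [|t [u [tC uC sE]]] := IHs; first by move=> x xs; rewrite sC // inE xs orbT.
have := sC c (mem_head _ _); rewrite big_cons mem_cat => /orP[]/mapP[d d_in ->].
  exists (d :: t), u; rewrite big_cons sE pair_addE add0r; split=> // x.
  by rewrite inE => /orP[/eqP->|/tC].
exists t, (d :: u); rewrite big_cons sE pair_addE add0r; split=> // x.
by rewrite inE => /orP[/eqP->|/uC].
Qed.

(** Induction on the list of coordinates being compared, for all predicates at once, because the
    step passes to slices of [Q] with one entry fixed. *)
Lemma dickson (K : finType) (P : {ffun K -> nat} -> Prop) :
  exists s : seq {ffun K -> nat}, {in s, forall x, P x} /\
    forall y, P y -> exists2 x, x \in s & exists d, y = x + d.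
Proof.
suff dick (r : seq K) (Q : {ffun K -> nat} -> Prop) :
    exists s : seq {ffun K -> nat}, {in s, forall x, Q x} /\
    forall y, Q y -> exists2 x, x \in s & {in r, forall i, x i <= y i}%N.
  have [s [sP leP]] := dick (enum K) P; exists s; split=> // y /leP[x xs le_xy].
  exists x => //; exists [ffun i => y i - x i]%N; apply/ffunP=> i.
  by rewrite !ffunE natrDE subnKC // le_xy ?mem_enum.
elim: r Q => [|i r IHr] Q.
  have [[x Qx]|noQ] := classic (exists x, Q x).
    by exists [:: x]; split=> [y|y _]; [rewrite inE => /eqP-> | exists x; rewrite ?mem_head].
  by exists [::]; split=> // y Qy; case: noQ; exists y.
have [s [sQ les]] := IHr Q.
(* Above the bound [m], domination on [r] by a member of [s] extends to [i]. The finitely many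
   slices with [i]-th entry below [m] are treated one by one with [IHr]. *)
pose m := (\max_(x <- s) x i)%N.
have [t [tQ let_]]: exists t : seq {ffun K -> nat}, {in t, forall x, Q x} /\
    forall y, Q y -> (y i < m)%N -> exists2 x, x \in t & {in i :: r, forall j, x j <= y j}%N.
  elim: m => [|m [t [tQ let_]]]; first by exists [::].
  have [u [uQ leu]] := IHr (fun y => Q y /\ y i = m).
  exists (t ++ u); split=> [x|y Qy].
    by rewrite mem_cat => /orP[/tQ|/uQ[]].
  rewrite ltnS leq_eqVlt => /orP[/eqP yi|yi].
    have [x xu le_xy] := leu y (conj Qy yi).
    exists x; first by rewrite mem_cat xu orbT.
    by move=> j; rewrite inE => /orP[/eqP->|/le_xy//]; rewrite yi (uQ x xu).2.
  by have [x xt le_xy] := let_ y Qy yi; exists x; rewrite // mem_cat xt.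
exists (s ++ t); split=> [x|y Qy].
  by rewrite mem_cat => /orP[/sQ|/tQ].
have [lt_ym|le_my] := ltnP (y i) m.
  by have [x xt le_xy] := let_ y Qy lt_ym; exists x; rewrite // mem_cat xt orbT.
have [x xs le_xy] := les y Qy; exists x; first by rewrite mem_cat xs.
move=> j; rewrite inE => /orP[/eqP->|/le_xy//].
by apply: leq_trans le_my; apply: leq_bigmax_seq.
Qed.

(** A coset-like condition without subtraction: a translation taking one point of [Z] into [Z] does
    so for every point. Solution sets of linear equations satisfy it, also when the equation is read
    in a group. *)
Definition affine (V : nmodType) (Z : V -> Prop) : Prop :=
  forall u v u', Z u -> Z (u + v) -> Z u' -> Z (u' + v).

(* The translations preserving [Z] form a submonoid closed under subtraction,
   hence generated by its minimal nonzero elements; [Z] is the union of the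
   translates of this submonoid by the minimal elements of [Z]. *)
Lemma semilinear_affine (K : finType) (Z : {ffun K -> nat} -> Prop) :
  affine Z -> semilinear Z.
Proof.
move=> affZ; have [[z Zz]|Z0] := classic (exists z, Z z); last first.
  apply: semilinear_ext (semilinear_empty _) => v; split=> // Zv.
  by case: Z0; exists v.
have [s [sZ leZ]] := dickson Z.
have [C [CZ leC]] := dickson (fun v => v <> 0 /\ Z (z + v)).
exists [seq (b, C) | b <- s] => v; split=> [/[dup] Zv /leZ[b bs [d vE]]|].
  exists (b, C); first by apply: map_f.
  suff [t tC dE]: exists2 t, {subset t <= C} & d = \sum_(c <- t) c.
    by exists t => //=; rewrite vE dE.
  have {Zv vE}: Z (z + d) by apply: affZ Zz; [exact: sZ b bs | rewrite -vE].
  have [n] := ubnP (\sum_i d i)%N; elim: n d => // n IHn d le_dn Zd.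
  have [->|/eqP d_neq0] := eqVneq d 0; first by exists [::]; rewrite ?big_nil.
  have [c cC [e dE]] := leC d (conj d_neq0 Zd).
  have [c_neq0 Zc] := CZ c cC.
  have [||t tC eE] := IHn e.
  - apply: (@leq_trans (\sum_i d i)%N); last exact: le_dn.
    have -> : (\sum_i d i = \sum_i c i + \sum_i e i)%N.
      by rewrite -big_split; apply: eq_bigr => i _; rewrite dE ffunE natrDE.
    rewrite -[X in (X < _)%N]add0n ltn_add2r lt0n; apply/eqP=> c0.
    case: c_neq0; apply/ffunP=> i; rewrite ffunE; apply/eqP.
    by move/eqP: c0; rewrite sum_nat_eq0 => /forallP/(_ i).
  - by apply: affZ Zz; [exact: Zc | rewrite -addrA -dE].
  exists (c :: t); last by rewrite big_cons dE eE.
  by move=> x; rewrite inE => /orP[/eqP->|/tC].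
case=> _ /mapP[b bs ->] [t /= tC ->].
have: Z b by apply: sZ.
elim: t b {bs} tC => [|c t IHt] b tC Zb; first by rewrite big_nil addr0.
rewrite big_cons addrA; apply: IHt; first by move=> x xt; rewrite tC // inE xt orbT.
by apply: affZ Zb; [exact: Zz | apply: (CZ c (tC c (mem_head _ _))).2].
Qed.

Definition delta (K : finType) (i : K) : {ffun K -> nat} := [ffun j => (j == i) : nat].

Definition comb (V : nmodType) (C : seq V) (y : {ffun 'I_(size C) -> nat}) : V :=
  \sum_(i < size C) C`_i *+ y i.

Lemma comb0 (V : nmodType) (C : seq V) : comb (0 : {ffun 'I_(size C) -> nat}) = 0.
Proof. by rewrite /comb big1 // => i _; rewrite ffunE mulr0n. Qed.

Lemma combD (V : nmodType) (C : seq V) : {morph @comb V C : x y / x + y}.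
Proof.
move=> x y; rewrite /comb -big_split; apply: eq_bigr => i _ /=.
by rewrite ffunE natrDE mulrnDr.
Qed.

Lemma comb_delta (V : nmodType) (C : seq V) (i : 'I_(size C)) : @comb V C (delta i) = C`_i.
Proof.
rewrite /comb (bigD1 i) //= ffunE eqxx mulr1n big1 ?addr0 // => j j_neq_i.
by rewrite ffunE (negbTE j_neq_i).
Qed.

Lemma linear_setE (V : nmodType) (b : V) C v :
  linear_set b C v <-> exists y, v = b + @comb V C y.
Proof.
split=> [[s sC ->]|[y ->]].
  suff [y ->]: exists y, \sum_(c <- s) c = @comb V C y by exists y.
  elim: s sC => [|c s IHs] sC; first by exists 0; rewrite comb0 big_nil.
  have [|y yE] := IHs; first by move=> x xs; rewrite sC // inE xs orbT.
  have c_lt : (index c C < size C)%N by rewrite index_mem sC ?mem_head.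
  exists (delta (Ordinal c_lt) + y).
  by rewrite big_cons yE combD comb_delta /= nth_index // -index_mem.
exists (flatten [seq nseq (y i) C`_i | i <- enum 'I_(size C)]).
  move=> x /flatten_mapP[i _]; rewrite mem_nseq => /andP[_ /eqP->].
  by rewrite mem_nth.
congr (_ + _); rewrite /comb big_flatten big_map big_enum /=.
by apply: eq_bigr => i _; rewrite big_nseq iter_addr_0.
Qed.

(** On each linear piece of [A], the set [Z] is pulled back to the coefficient vectors, where it is
    still affine and [semilinear_affine] applies; the result is then mapped forward. *)
Lemma semilinear_capA (V : nmodType) (A Z : V -> Prop) :
  semilinear A -> affine Z -> semilinear (fun v => A v /\ Z v).
Proof.
move=> [l lP] affZ.
have sl p : p \in l -> semilinear
    (fun v => exists2 y, Z (p.1 + @comb V p.2 y) & v = p.1 + comb y).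
  move=> _; apply: semilinear_image (comb0 _) (@combD _ _) _.
  apply: semilinear_affine => u v u' Zu Zuv Zu'.
  by rewrite combD addrA; apply: affZ Zu _ Zu'; rewrite -addrA -combD.
apply: semilinear_ext (semilinear_bigunion sl) => v; split.
  by case=> p pl [y Zy ->]; split=> //; apply/lP; exists p => //; apply/linear_setE; exists y.
by case=> /lP[p pl /linear_setE[y vE]] Zv; exists p => //; exists y; rewrite -?vE.
Qed.

Lemma semilinear_full (K : finType) : semilinear (fun _ : {ffun K -> nat} => True).
Proof. exact: semilinear_affine. Qed.

Lemma semilinear_nat : semilinear (fun _ : nat => True).
Proof.
exists [:: (0, [:: 1%N])] => n; split=> // _; exists (0, [:: 1%N]); rewrite ?mem_head //.
apply/linear_setE; exists [ffun=> n].
by rewrite /comb big_ord1 ffunE add0r /= natn.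
Qed.

(** The intersection is the projection of the part of the product lying on the diagonal, which is
    affine because natural numbers cancel. *)
Lemma semilinear_cap (K : finType) (A B : {ffun K -> nat} -> Prop) :
  semilinear A -> semilinear B -> semilinear (fun v => A v /\ B v).
Proof.
move=> slA slB; pose diag (z : {ffun K -> nat} * {ffun K -> nat}) := z.1 = z.2.
have affd : affine diag.
  move=> u v u'; rewrite /diag /= => -> /ffunP uv ->; congr (_ + _).
  by apply/ffunP=> i; have := uv i; rewrite !ffunE !natrDE => /addnI.
have := semilinear_image 0 (f := fst) erefl (fun _ _ => erefl)
  (semilinear_capA (semilinear_prod slA slB) affd).
apply: semilinear_ext => v; split=> [[z [[Az Bz] zz] ->]|[Av Bv]].
  by rewrite add0r; split=> //; rewrite [z.1]zz.
by exists (v, v); rewrite ?add0r.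
Qed.

(** A slack variable turns the inequality into an affine equation and is then projected away. *)
Lemma semilinear_le (V : nmodType) (A : V -> Prop) (f g : V -> nat) (a c : nat) :
  {morph f : u v / u + v} -> {morph g : u v / u + v} ->
  semilinear A -> semilinear (fun v => A v /\ (a + f v <= c + g v)%N).
Proof.
move=> fD gD slA.
pose Z (z : V * nat) := (a + f z.1 + z.2 = c + g z.1)%N.
have affZ : affine Z.
  by move=> [u s] [v t] [u' s']; rewrite /Z /= !fD !gD !natrDE; lia.
have := semilinear_image 0 (f := fst) erefl (fun _ _ => erefl)
  (semilinear_capA (semilinear_prod slA semilinear_nat) affZ).
apply: semilinear_ext => v; split=> [[[x s] [[/= Ax _]] xs ->]|[Av le_fg]].
  by rewrite add0r; split=> //; move: xs; rewrite /Z /=; lia.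
exists (v, c + g v - (a + f v))%N; rewrite ?add0r //.
by split=> //; rewrite /Z /= subnKC.
Qed.

(** The complement is upward closed, so by Dickson's lemma it consists of the vectors above one of
    finitely many [x]. Not being above [x] means having some entry below that of [x]. *)
Lemma semilinear_downclosed (K : finType) (D : {ffun K -> nat} -> Prop) :
  (forall u v, D (u + v) -> D u) -> semilinear D.
Proof.
move=> downD; have [s [sD les]] := dickson (fun v => ~ D v).
suff: semilinear (fun v : {ffun K -> nat} => forall x, x \in s -> exists i, (v i < x i)%N).
  apply: semilinear_ext => v; split=> [lt_s|Dv x xs].
    apply: NNPP => /les[x /lt_s[i]] + [d vE].
    by rewrite vE ffunE natrDE ltnNge leq_addr.
  apply: NNPP => no_lt; apply: (sD x xs).
  apply: (downD _ [ffun i => v i - x i]%N).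
  suff -> : x + [ffun i => (v i - x i)%N] = v by [].
  apply/ffunP=> i; rewrite !ffunE natrDE subnKC // leqNgt; apply/negP=> lt_i.
  by case: no_lt; exists i.
elim: s {sD les} => [|x s IHs].
  by apply: semilinear_ext (semilinear_full K).
(* [z] fixes a coordinate [i] and one of the finitely many values below [x i]; having this value
   there is an affine condition. *)
have sl1 (z : {i : K & 'I_(x i)}) : semilinear (fun v : {ffun K -> nat} =>
    (forall x, x \in s -> exists i, (v i < x i)%N) /\ v (tag z) = tagged z).
  apply: semilinear_capA => // u v u' /= uz + u'z.
  by rewrite !ffunE uz u'z.
have := semilinear_bigunion (r := enum {: {i : K & 'I_(x i)}}) (fun z _ => sl1 z).
apply: semilinear_ext => v; split=> [[[i a] _ /= [lt_s va]] y|lt_s].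
  rewrite inE => /orP[/eqP->|/lt_s//].
  by exists i; rewrite va.
have [i lt_i] := lt_s x (mem_head _ _).
exists (Tagged (fun i => 'I_(x i)) (Ordinal lt_i)); first by rewrite mem_enum.
by split=> // y ys; apply: lt_s; rewrite inE ys orbT.
Qed.

End Semilinear.

(** * Lightest elements of a linear set *)

Lemma ex_minimal (P : nat -> Prop) :
  (exists n, P n) -> exists2 m, P m & forall n, P n -> m <= n.
Proof.
move=> [n Pn]; apply: NNPP => noMin.
elim/ltn_ind: n Pn => n IHn Pn; case: noMin; exists n => // k Pk.
by rewrite leqNgt; apply/negP=> /IHn.
Qed.

Section Competitors.

Set Implicit Arguments.
Unset Strict Implicit.
Import GRing.Theory.
Local Open Scope ring_scope.

Variables (E : finType) (G : groupType).
Local Notation V := {ffun E -> nat}.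
Variables (phi : V -> G) (wt : V -> nat).
Hypothesis phiD : forall u v, phi (u + v) = (phi u * phi v)%g.
Hypothesis wtD : {morph wt : u v / u + v}.

Lemma phi_addr u v w : (phi (u + w) = phi (v + w)) <-> phi u = phi v.
Proof. by rewrite !phiD; split=> [/mulIg|->]. Qed.

(** Cancelling the equation at [u] from the one at [u + v] leaves [phi (f v) = phi (g v)], which
    does not mention the translated point. *)
Lemma affine_phi (W : nmodType) (f g : W -> V) (a : V) :
  {morph f : u v / u + v} -> {morph g : u v / u + v} ->
  affine (fun w => phi (f w) = phi (a + g w)).
Proof.
move=> fD gD u v u' /= fu; rewrite !fD !gD !(addrA a).
rewrite (phiD (f u)) (phiD (a + g u)) fu => /mulgI fv fu'.
by rewrite phiD fu' fv -phiD.
Qed.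

Variables (b : V) (C : seq V).

(* [k] encodes a triple (x, y, z): its entries at [inl _], [inr (inl _)] and
   [inr (inr _)] are those of x, y and z respectively. *)
Local Notation K := ('I_(size C) + (E + E))%type.

Definition lhs (k : {ffun K -> nat}) : V := [ffun e => k (inr (inr e))].
Definition rhs (k : {ffun K -> nat}) : V :=
  comb [ffun i => k (inl i)] + [ffun e => k (inr (inl e))].
Definition penalty (k : {ffun K -> nat}) : nat := (\sum_e k (inr e))%N.
Definition no_costlier k k' : Prop :=
  (penalty k < penalty k')%N \/ penalty k = penalty k' /\ (wt (rhs k) <= wt (rhs k'))%N.

Lemma lhsD : {morph lhs : u v / u + v}.
Proof. by move=> u v; apply/ffunP=> e; rewrite !ffunE. Qed.

Lemma rhsD : {morph rhs : u v / u + v}.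
Proof.
move=> u v; rewrite /rhs addrACA -combD; congr (comb _ + _).
  by apply/ffunP=> i; rewrite !ffunE.
by apply/ffunP=> e; rewrite !ffunE.
Qed.

Lemma penaltyD : {morph penalty : u v / u + v}.
Proof.
by move=> u v; rewrite /penalty natrDE -big_split; apply: eq_bigr => e _; rewrite ffunE.
Qed.

(** The rivals of [k] are the triples with the same quotient of the values of [rhs] and [lhs],
    written without inverses. Neither [n] nor [b] occurs, so one set serves all [n]. *)
Definition optimal k : Prop :=
  forall k', phi (rhs k + lhs k') = phi (rhs k' + lhs k) -> no_costlier k k'.

(** Adding [v] to both rivals keeps them rivals and shifts their costs equally, so a summand of an
    optimal triple is optimal. *)
Lemma semilinear_optimal : semilinear optimal.
Proof.
apply: semilinear_downclosed => u v opt k' k'u.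
have: no_costlier (u + v) (k' + v).
  apply: opt; rewrite !rhsD !lhsD [X in phi X = _]addrACA [X in _ = phi X]addrACA.
  by apply/phi_addr.
rewrite /no_costlier !penaltyD !rhsD !wtD !natrDE; lia.
Qed.

Lemma optimal_exists n :
  exists2 k, optimal k & phi (n + lhs k) = phi (b + rhs k).
Proof.
pose sol k := phi (n + lhs k) = phi (b + rhs k).
have [|p [k0 sol0 <-] minp] := ex_minimal (P := fun p => exists2 k, sol k & penalty k = p).
  (* The triple (0, n, b) is always a solution, since n + b = b + n. *)
  pose k : {ffun K -> nat} := [ffun i => match i with
    | inl _ => 0%N | inr (inl e) => n e | inr (inr e) => b e end].
  exists (penalty k), k => //; rewrite /sol addrC; congr (phi (_ + _)).
    by apply/ffunP=> e; rewrite !ffunE.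
  rewrite /rhs -[LHS]add0r; congr (_ + _); last by apply/ffunP=> e; rewrite !ffunE.
  by rewrite -(comb0 C); congr comb; apply/ffunP=> e; rewrite !ffunE.
have [|q [k [solk pk] <-] minq] := ex_minimal
    (P := fun q => exists2 k, sol k /\ penalty k = penalty k0 & wt (rhs k) = q).
  by exists (wt (rhs k0)), k0.
exists k => // k' kk'.
(* Rivals of a solution are solutions: after adding [rhs k + lhs k] to both sides, the claim is the
   product of [solk] and [kk']. *)
have solk' : sol k'.
  apply/(phi_addr _ _ (rhs k + lhs k)).
  rewrite [LHS](_ : _ = phi ((n + lhs k) + (rhs k + lhs k'))); last first.
    by congr phi; apply/ffunP=> e; rewrite !ffunE !natrDE; lia.
  rewrite phiD solk kk' -phiD; congr phi.
  by apply/ffunP=> e; rewrite !ffunE !natrDE; lia.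
have := minp _ (ex_intro2 _ _ _ solk' erefl).
rewrite /no_costlier leq_eqVlt pk => /orP[/eqP pk'|]; last by left.
by right; split=> //; apply: minq; exists k'.
Qed.

Definition beats_all n : Prop :=
  forall m, linear_set b C m -> phi m = phi n -> (wt n <= wt m)%N.

(* The inequalities have the shape produced by [semilinear_le]. *)
Lemma beats_allE n : beats_all n <->
  exists2 k, optimal k /\ phi (n + lhs k) = phi (b + rhs k) &
    (1 + 0 <= 0 + penalty k)%N \/ (0 + wt n <= wt b + wt (rhs k))%N.
Proof.
split=> [best|[k [opt solk] le_wt] m /linear_setE[x ->] xn].
  have [k opt solk] := optimal_exists n; exists k => //.
  (* With zero penalty, b + C x lies in the linear set and has the value of [n], so [best] applies
     to it. *)
  have [pk0|] := posnP (penalty k); last by left.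
  right; rewrite add0n -[X in (_ <= X)%N]natrDE -[X in (_ <= X)%N]wtD; apply: best.
    apply/linear_setE; exists [ffun i => k (inl i)]; congr (_ + _).
    rewrite /rhs -[RHS]addr0; congr (_ + _); apply/ffunP=> e; rewrite !ffunE.
    by move/eqP: pk0; rewrite sum_nat_eq0 => /forallP/(_ (inl e))/eqP.
  rewrite -solk -[X in _ = phi X]addr0; congr (phi (_ + _)).
  apply/ffunP=> e; rewrite !ffunE.
  by move/eqP: pk0; rewrite sum_nat_eq0 => /forallP/(_ (inr e))/eqP.
(* An element b + C x with the value of [n] yields the rival (x, 0, 0) of zero penalty. Optimality
   forces [penalty k] to be 0 and [rhs k] to be no heavier than C x. *)
pose k' : {ffun K -> nat} := [ffun i => if i is inl j then x j else 0%N].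
have rk' : rhs k' = comb x.
  rewrite /rhs -[RHS]addr0; congr (comb _ + _); apply/ffunP=> e; rewrite !ffunE //.
have lk' : lhs k' = 0 by apply/ffunP=> e; rewrite !ffunE.
have pk' : penalty k' = 0%N by rewrite /penalty big1 // => e _; rewrite ffunE.
have : phi (rhs k + lhs k') = phi (rhs k' + lhs k).
  rewrite rk' lk' addr0; apply/(phi_addr _ _ b).
  rewrite addrC -solk phiD -xn -phiD; congr phi.
  by rewrite (addrC b) addrAC.
move/opt; rewrite /no_costlier pk' rk' => -[//|[pk le_k]].
by rewrite pk in le_wt; case: le_wt => // le_wt; rewrite wtD natrDE; lia.
Qed.

Lemma semilinear_beats_all : semilinear beats_all.
Proof.
pose sol (z : V * {ffun K -> nat}) := phi (z.1 + lhs z.2) = phi (b + rhs z.2).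
have sl : semilinear (fun z : V * {ffun K -> nat} => (True /\ optimal z.2) /\ sol z).
  apply: semilinear_capA; first exact: semilinear_prod (semilinear_full E) semilinear_optimal.
  apply: affine_phi => u v /=; last by rewrite rhsD.
  by rewrite lhsD addrACA.
have sl1 := semilinear_le (f := fun=> 0%N) (g := fun z => penalty z.2) 1 0
  (fun _ _ => erefl) (fun u v => penaltyD u.2 v.2) sl.
have sl2 := semilinear_le (f := fun z => wt z.1) (g := fun z => wt (rhs z.2)) 0 (wt b)
  (fun u v => wtD u.1 v.1) (fun u v => etrans (congr1 wt (rhsD u.2 v.2)) (wtD _ _)) sl.
have := semilinear_image 0 (f := fst) erefl (fun _ _ => erefl)
  (semilinear_union sl1 sl2).
apply: semilinear_ext => n; rewrite beats_allE; split.
  move=> [[m k] [] [[[_ opt] solk] le_k] ->]; rewrite add0r.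
    by exists k; [split | left].
  by exists k; [split | right].
case=> k [opt solk] le_k; exists (n, k); rewrite ?add0r //.
by case: le_k; [left | right].
Qed.

End Competitors.

(** * Edge counts of paths *)

Section Paths.

Set Implicit Arguments.
Unset Strict Implicit.
Import GRing.Theory.
Local Open Scope ring_scope.

Variables (I S : finType) (next : I -> S -> I).
Local Notation V := {ffun I * S -> nat}.
Local Notation run := (foldl next).

Fixpoint edge_count (i : I) (w : seq S) : V :=
  if w is s :: w' then delta (i, s) + edge_count (next i s) w' else 0.

Definition visits (i : I) (w : seq S) : seq I := i :: scanl next i w.

Lemma edge_count_cat i u w :
  edge_count i (u ++ w) = edge_count i u + edge_count (run i u) w.
Proof. by elim: u i => [|s u IHu] i /=; rewrite ?add0r // IHu addrA. Qed.

Lemma edge_count_rcons i w s :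
  edge_count i (rcons w s) = edge_count i w + delta (run i w, s).
Proof. by rewrite -cats1 edge_count_cat /= addr0. Qed.

Lemma visits_cat i u w : visits i (u ++ w) = visits i u ++ scanl next (run i u) w.
Proof. by rewrite /visits scanl_cat. Qed.

Lemma mem_visits_catl i u w : {subset visits i u <= visits i (u ++ w)}.
Proof. by move=> j ju; rewrite visits_cat mem_cat ju. Qed.

Lemma mem_visits_run i w : run i w \in visits i w.
Proof.
elim: w i => [|s w IHw] i; first exact: mem_head.
by rewrite inE; apply/orP; right; apply: IHw.
Qed.

Lemma visitsP i w j :
  reflect (exists u v, w = u ++ v /\ run i u = j) (j \in visits i w).
Proof.
apply: (iffP idP) => [|[u [v [-> <-]]]]; last first.
  exact: mem_visits_catl (mem_visits_run i u).
elim: w i => [|s w IHw] i.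
  by rewrite inE => /eqP->; exists [::], [::].
rewrite inE => /orP[/eqP->|/IHw[u [v [-> <-]]]].
  by exists [::], (s :: w).
by exists (s :: u), v.
Qed.

Definition words (n : nat) : seq (seq S) :=
  flatten [seq [seq val t | t <- enum {: m.-tuple S}] | m <- iota 0 n.+1].

Lemma mem_words n w : (w \in words n) = (size w <= n)%N.
Proof.
apply/flatten_mapP/idP => [[m]|le_wn].
  rewrite mem_iota ltnS => /andP[_ le_mn] /mapP[t _ ->].
  by rewrite size_tuple.
exists (size w); first by rewrite mem_iota ltnS.
by apply/mapP; exists (in_tuple w); rewrite ?mem_enum.
Qed.

Definition loops (i : I) (w : seq S) : seq V :=
  flatten [seq [seq edge_count j c | c <- words #|I| & run j c == j] | j <- visits i w].

Lemma loopsP i w v : reflect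
  (exists j c, [/\ j \in visits i w, (size c <= #|I|)%N, run j c = j & v = edge_count j c])
  (v \in loops i w).
Proof.
apply: (iffP flatten_mapP) => [[j ji /mapP[c]]|[j [c [ji cI /eqP jc ->]]]].
  by rewrite mem_filter mem_words => /andP[/eqP jc cI] ->; exists j, c.
by exists j => //; apply/map_f; rewrite mem_filter jc mem_words.
Qed.

Lemma sub_loops i u w : {subset visits i u <= visits i w} -> {subset loops i u <= loops i w}.
Proof.
by move=> uw v /loopsP[j [c [/uw jw cI jc ->]]]; apply/loopsP; exists j, c.
Qed.

(** Each loop is inserted where the path visits its base vertex. This keeps the end of the path and
    loses no visited vertex, so the remaining loops can still be inserted. *)
Lemma linear_loops_sound i b v : linear_set (edge_count i b) (loops i b) v ->
  exists2 w, run i w = run i b & edge_count i w = v.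
Proof.
case=> s sC ->; suff [w [rw bw wE]]: exists w, [/\ run i w = run i b,
    {subset visits i b <= visits i w} & edge_count i w = edge_count i b + \sum_(c <- s) c].
  by exists w.
elim: s sC => [|x s IHs] sC; first by exists b; split; rewrite // big_nil addr0.
have [|w [rw bw wE]] := IHs; first by move=> y ys; rewrite sC // inE ys orbT.
have /loopsP[j [c [/bw/visitsP[u [v' [wuv uj]]] _ jc xE]]] := sC x (mem_head _ _).
exists (u ++ c ++ v'); split.
- by rewrite -rw wuv !foldl_cat uj jc.
- move=> k /bw; rewrite wuv !visits_cat scanl_cat !mem_cat uj jc.
  by case/orP=> ->; rewrite ?orbT.
rewrite big_cons xE addrCA -wE wuv !edge_count_cat uj jc.
by rewrite addrCA.
Qed.

Lemma size_uniq_visits i w : uniq (visits i w) -> (size w < #|I|)%N.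
Proof.
by move/card_uniqP; rewrite /= size_scanl => <-; apply: max_card.
Qed.

(* Reading [w] from left to right, [b] is kept as [u ++ x], where [u] ends at
   the latest vertex seen for the first time and [x] is a simple path through
   vertices of [u]; a loop closed by the next letter is cut off from [x]. *)
Lemma linear_loops_complete i w : exists b, [/\ (size b <= #|I| * #|I| + #|I|)%N,
  run i b = run i w & linear_set (edge_count i b) (loops i b) (edge_count i w)].
Proof.
(* Only [loops i u] is used: [x] stays on vertices of [u], so loops cut from [x] are based there and
   survive later changes of [x]. *)
suff [u [x [su rE xu xU lin]]]: exists u x,
    [/\ (size u <= #|I| * #|[pred j in visits i u]|)%N, run i (u ++ x) = run i w,
        {subset visits (run i u) x <= visits i u}, uniq (visits (run i u) x)
      & linear_set (edge_count i (u ++ x)) (loops i u) (edge_count i w)].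
  exists (u ++ x); split=> //.
    rewrite size_cat leq_add ?(ltnW (size_uniq_visits xU)) //.
    by apply: leq_trans su _; rewrite leq_mul2l max_card orbT.
  case: lin => s sC ->; exists s => // c /sC.
  exact/sub_loops/mem_visits_catl.
elim/last_ind: w => [|w s [u [x [su rE xu xU [t tC wE]]]]].
  exists [::], [::]; split=> //; exists [::] => //=.
  by rewrite big_nil addr0.
rewrite foldl_rcons edge_count_rcons -rE; set j := next _ s.
have sx := size_uniq_visits xU.
have [ju|j'u] := boolP (j \in visits i u); last first.
  have jb : j \in visits i (rcons (u ++ x) s) by rewrite /j -foldl_rcons mem_visits_run.
  exists (rcons (u ++ x) s), [::]; rewrite cats0 foldl_rcons; split=> //.
  - have le_card : (#|[pred k in visits i u]| < #|[pred k in visits i (rcons (u ++ x) s)]|)%N.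
      apply/proper_card/properP; split; last by exists j.
      by rewrite -cats1 -catA; apply/subsetP=> k; apply: mem_visits_catl.
    (* The simple path [x] has fewer than [#|I|] letters, so each new vertex lengthens [u] by at
       most [#|I|]. *)
    apply: leq_trans (_ : #|I| * #|[pred k in visits i u]|.+1 <= _)%N.
      by rewrite size_rcons size_cat -addnS mulnS [X in (X <= _)%N]addnC leq_add.
    by rewrite leq_mul2l le_card orbT.
  - by move=> k; rewrite inE => /eqP->; rewrite -foldl_rcons mem_visits_run.
  exists t; first by move=> c /tC; apply: sub_loops; rewrite -cats1 -catA; apply: mem_visits_catl.
  by rewrite edge_count_rcons wE addrAC.
have jE : next (run (run i u) x) s = j by rewrite /j foldl_cat.
have [/visitsP[y [z [xyz yj]]]|j'x] := boolP (j \in visits (run i u) x); last first.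
  exists u, (rcons x s); split=> //.
  - by rewrite -rcons_cat foldl_rcons.
  - move=> k; rewrite -cats1 visits_cat mem_cat => /orP[/xu//|].
    by rewrite /= jE inE => /eqP->.
  - by rewrite -cats1 visits_cat [scanl _ _ _]/= jE cats1 rcons_uniq j'x.
  by exists t => //; rewrite -rcons_cat edge_count_rcons wE addrAC.
exists u, y; split=> //.
- by rewrite foldl_cat.
- by move=> k ky; apply: xu; rewrite xyz mem_visits_catl.
- by move: xU; rewrite xyz visits_cat cat_uniq => /andP[].
exists (edge_count j (rcons z s) :: t).
  move=> c; rewrite inE => /orP[/eqP->|/tC//]; apply/loopsP.
  exists j, (rcons z s); split=> //.
    by rewrite size_rcons (leq_ltn_trans _ sx) // xyz size_cat leq_addl.
  by rewrite foldl_rcons -{1}yj -foldl_cat -xyz.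
rewrite big_cons edge_count_rcons wE xyz !edge_count_cat !foldl_cat yj.
by rewrite -!addrA; do 3!congr (_ + _); rewrite addrC.
Qed.

Lemma edge_count_paths i j v :
  (exists2 w, run i w = j & edge_count i w = v) <->
  exists2 b, b \in [seq b <- words (#|I| * #|I| + #|I|) | run i b == j]
    & linear_set (edge_count i b) (loops i b) v.
Proof.
split=> [[w rw <-]|[b]].
  have [b [sb rb lin]] := linear_loops_complete i w.
  by exists b; rewrite // mem_filter mem_words rb rw eqxx.
rewrite mem_filter => /andP[/eqP rb _] /linear_loops_sound[w rw wv].
by exists w; rewrite ?rw.
Qed.

End Paths.

(** * From semilinear sets to automata *)

Section Automaton.

Set Implicit Arguments.
Unset Strict Implicit.
Import GRing.Theory.
Local Open Scope ring_scope.

Variables (I S : finType) (next : I -> S -> I) (i0 : I).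
Local Notation V := {ffun I * S -> nat}.
Local Notation run := (foldl next).
Variable l : I -> seq (V * seq V).

Definition counters (v : V) : 'rV[int]_#|{: I * S}| := \row_j (v (enum_val j))%:Z.

Lemma countersD : {morph counters : u v / u + v}.
Proof. by move=> u v; apply/rowP=> j; rewrite !mxE ffunE natrDE PoszD. Qed.

Lemma counters0 : counters 0 = 0.
Proof. by apply/rowP=> j; rewrite !mxE ffunE. Qed.

Lemma counters_inj : injective counters.
Proof.
move=> u v /rowP uv; apply/ffunP=> e.
by have := uv (enum_rank e); rewrite !mxE enum_rankK => -[].
Qed.

(** All lists are merged so that positions form a finite type of states; [guessing] moves are
    restricted to the pieces that belong to the current vertex. *)
Definition pieces : seq (V * seq V) := flatten [seq l i | i <- enum I].

Definition piece (p : 'I_(size pieces)) : V * seq V := nth (0, [::]) pieces p.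

Lemma ex_piece i p : p \in l i -> exists q, piece q = p.
Proof.
move=> pi; have p_in : p \in pieces by apply/flatten_mapP; exists i; rewrite ?mem_enum.
by move: (p_in); rewrite -index_mem => lt_p; exists (Ordinal lt_p); rewrite /piece nth_index.
Qed.

Local Notation state := (I + 'I_(size pieces))%type.
Local Notation move := ((state * label S) * (state * 'rV[int]_#|{: I * S}|))%type.

Definition reading (e : I * S) : move :=
  ((inl e.1, Letter e.2), (inl (next e.1 e.2), counters (delta e))).
Definition guessing (i : I) (p : 'I_(size pieces)) : move :=
  ((inl i, EndOfTape), (inr p, - counters (piece p).1)).
Definition checking (p : 'I_(size pieces)) (c : V) : move :=
  ((inr p, EndOfTape), (inr p, - counters c)).

Definition moves : seq move :=
  [seq reading e | e <- enum {: I * S}] ++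
  [seq guessing i p | i <- enum I, p <- [seq p <- enum {: 'I_(size pieces)} | piece p \in l i]] ++
  [seq checking p c | p <- enum {: 'I_(size pieces)}, c <- (piece p).2].

(** States [inl i] follow the path and count its edges. The move to [inr p] requires the end of the
    tape, hence is made at the final vertex; the base of piece [p] is subtracted there, then its
    generators any number of times. *)
Definition counter_automaton : blind_counter_automaton #|{: I * S}| S :=
  {| bca_state := state; bca_delta := [fset m in moves]%fset;
     bca_init := inl i0; bca_final := [set q | if q is inr _ then true else false] |}.

Lemma mem_bca_delta m : (m \in bca_delta counter_automaton) = (m \in moves).
Proof. by rewrite /= in_fset. Qed.

Lemma movesP m : m \in bca_delta counter_automaton ->
  [\/ exists e, m = reading e,
      exists i (p : 'I_(size pieces)), piece p \in l i /\ m = guessing i p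
    | exists (p : 'I_(size pieces)) c, c \in (piece p).2 /\ m = checking p c].
Proof.
rewrite mem_bca_delta /moves !mem_cat.
case/or3P=> [/mapP[e _ ->]|/allpairsPdep[i [p [_ + ->]]]|/allpairsPdep[p [c [_ pc ->]]]].
- by constructor 1; exists e.
- by rewrite mem_filter => /andP[pi _]; constructor 2; exists i, p.
- by constructor 3; exists p, c.
Qed.

Lemma reading_move e : reading e \in bca_delta counter_automaton.
Proof. by rewrite mem_bca_delta /moves !mem_cat map_f // mem_enum. Qed.

Lemma guessing_move i (p : 'I_(size pieces)) :
  piece p \in l i -> guessing i p \in bca_delta counter_automaton.
Proof.
move=> pi; rewrite mem_bca_delta /moves !mem_cat; apply/or3P; constructor 2.
apply/allpairsPdep; exists i, p; split=> //; first by rewrite mem_enum.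
by rewrite mem_filter pi mem_enum.
Qed.

Lemma checking_move (p : 'I_(size pieces)) c :
  c \in (piece p).2 -> checking p c \in bca_delta counter_automaton.
Proof.
move=> pc; rewrite mem_bca_delta /moves !mem_cat; apply/or3P; constructor 3.
by apply/allpairsPdep; exists p, c; split; rewrite ?mem_enum.
Qed.

(** Invariant of the runs on [w]: before the guess the counters hold the edge count of the prefix
    read; afterwards [v] is the amount already subtracted. *)
Definition reachable (w : seq S) (x : bca_config counter_automaton) : Prop :=
  match x.1.1 with
  | inl i => exists2 u, w = u ++ x.2 & i = run i0 u /\ x.1.2 = counters (edge_count next i0 u)
  | inr p => piece p \in l (run i0 w) /\ exists2 v, linear_set (piece p).1 (piece p).2 v
      & x.2 = [::] /\ x.1.2 + counters v = counters (edge_count next i0 w)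
  end.

Lemma reachable_step w x y :
  @bca_step _ _ counter_automaton x y -> reachable w x -> reachable w y.
Proof.
case=> [q p s v c w'|q p v c w'|q p v c] /movesP[[e]|[i [r [rl]]]|[r [d [dr]]]] //.
- move=> [-> -> -> ->] [u /= -> [e1 ->]]; exists (rcons u e.2); first by rewrite cat_rcons.
  by rewrite foldl_rcons -e1 edge_count_rcons -e1 -countersD /=; case: e {e1}.
- move=> [-> -> ->] [u /= ->]; rewrite cats0 => -[iu ->]; split; first by rewrite -iu.
  exists (piece r).1; last by rewrite subrK.
  by exists [::]; rewrite ?big_nil ?addr0.
move=> [-> -> ->] [/= rl [u [t tC uE] [_ cu]]]; split=> //.
exists (u + d); last by rewrite countersD addrACA cu addNr addr0.
exists (d :: t); last by rewrite big_cons uE addrAC addrA.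
by move=> x'; rewrite inE => /orP[/eqP->|/tC].
Qed.

Lemma reachable_init w : reachable w (inl i0, 0, w).
Proof. by exists [::] => //=; rewrite counters0. Qed.

Lemma read_word w c : clos_refl_trans _ (@bca_step _ _ counter_automaton)
  (inl i0, c, w) (inl (run i0 w), c + counters (edge_count next i0 w), [::]).
Proof.
elim: w i0 c => [|s w IHw] i c /=; first by rewrite counters0 addr0; apply: rt_refl.
rewrite countersD addrA; apply: rt_trans (IHw _ _); apply: rt_step.
exact/step_letter/(reading_move (i, s)).
Qed.

Lemma check_piece (p : 'I_(size pieces)) t c : {subset t <= (piece p).2} ->
  clos_refl_trans _ (@bca_step _ _ counter_automaton)
    (inr p, c + counters (\sum_(d <- t) d), [::]) (inr p, c, [::]).
Proof.
elim: t => [|d t IHt] tC; first by rewrite big_nil counters0 addr0; apply: rt_refl.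
apply: rt_trans (IHt _); last by move=> x xt; rewrite tC // inE xt orbT.
apply: rt_step; have := step_end _ (checking_move (tC d (mem_head _ _))).
move/(_ (c + counters (\sum_(d <- d :: t) d))).
by rewrite big_cons countersD [counters d + _]addrC addrA addrK.
Qed.

Theorem blind_multicounter_edge_count : blind_multicounter (fun w =>
  exists2 p, p \in l (run i0 w) & linear_set p.1 p.2 (edge_count next i0 w)).
Proof.
exists #|{: I * S}|, counter_automaton => w; split=> [[p pl [t tC wE]]|[q]].
  have [q qp] := ex_piece pl; rewrite -qp in pl tC wE.
  exists (inr q); first by rewrite inE.
  have := read_word w 0; rewrite add0r => rd; apply: rt_trans rd _.
  have := check_piece 0 tC; rewrite add0r => chk.
  apply: rt_trans chk; apply: rt_step.
  have := step_end (counters (edge_count next i0 w)) (guessing_move (p := q) pl).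
  by rewrite wE countersD [counters (piece q).1 + _]addrC addrK.
rewrite inE; case: q => // p _ st.
have: reachable w (inr p, 0, [::]).
  have := reachable_init w; elim: st => [x y|x|x y z _ IHxy _ IHyz].
  - exact: reachable_step.
  - by [].
  - by move/IHxy/IHyz.
case=> /= pl [v lin [_]]; rewrite add0r => /counters_inj <-.
by exists (piece p).
Qed.

End Automaton.

(** * Virtually abelian groups *)

Section VirtuallyAbelian.

Set Implicit Arguments.
Unset Strict Implicit.
Local Open Scope group_scope.

Variables (G : groupType) (S : {fset G}) (omega : S -> nat).
Variables (H : {pred G}) (T : seq G).
Hypothesis H_group : group_closed H.
Hypothesis H_abelian : {in H &, forall x y, commute x y}.
Hypothesis T_cover : forall g, exists2 t, t \in T & t^-1 * g \in H.

Let H1 : 1 \in H. Proof. by case: H_group. Qed.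

Let HV x : x \in H -> x^-1 \in H.
Proof. by move=> Hx; rewrite -[x^-1]mul1g; apply: H_group.2. Qed.

Let HM x y : x \in H -> y \in H -> x * y \in H.
Proof. by move=> Hx Hy; rewrite -[y]invgK; apply: H_group.2 => //; apply: HV. Qed.

Let HX x n : x \in H -> x ^+ n \in H.
Proof. by move=> Hx; elim: n => [|n IHn]; rewrite ?expg0 // expgS HM. Qed.

Local Notation I := 'I_(size T).

(* The right cosets H g are indexed by the first t in T with g t in H. *)
Lemma coset_index_subproof g : find (fun t => g * t \in H) T < size T.
Proof.
(* Inversion turns the given cover by left cosets into one by right cosets. *)
rewrite -has_find; apply/hasP; have [t tT Ht] := T_cover g^-1.
by exists t => //; rewrite -[g * t]invgK HV // invgM.
Qed.

Definition coset_index g : I := Ordinal (coset_index_subproof g).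
(** For [i = coset_index g], it is the inverse of [transl i] that represents the right coset H g. *)
Definition transl (i : I) : G := nth 1 T i.

Lemma transl_coset g : g * transl (coset_index g) \in H.
Proof.
have := coset_index_subproof g; rewrite -has_find.
exact: (@nth_find _ 1 (fun t => g * t \in H)).
Qed.

Lemma coset_indexM h g : h \in H -> coset_index (h * g) = coset_index g.
Proof.
move=> Hh; apply: val_inj => /=; apply: eq_find => t /=.
apply/idP/idP => [Hhgt|Hgt]; last by rewrite -mulgA HM.
by rewrite -[g * t](mulKg h) HM ?HV // mulgA.
Qed.

Definition coset_next (i : I) (s : S) : I := coset_index ((transl i)^-1 * val s).
(** The Schreier generator of H attached to the edge. *)
Definition edge_val (e : I * S) : G :=
  (transl e.1)^-1 * val e.2 * transl (coset_next e.1 e.2).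

Lemma coset_next_index g s : coset_next (coset_index g) s = coset_index (g * val s).
Proof.
rewrite /coset_next -(coset_indexM ((transl (coset_index g))^-1 * val s) (transl_coset g)).
by rewrite mulgA mulgK.
Qed.

Lemma edge_valH e : edge_val e \in H.
Proof. exact: transl_coset. Qed.

Definition phi (v : {ffun I * S -> nat}) : G := \prod_e edge_val e ^+ v e.

Lemma phiD u v : phi (u + v)%R = phi u * phi v.
Proof.
rewrite /phi; elim: (index_enum _) => [|e r IHr]; first by rewrite !big_nil mulg1.
rewrite !big_cons IHr ffunE natrDE expgnDr -!mulgA; congr (_ * _).
rewrite !mulgA; congr (_ * _); apply: H_abelian; first by rewrite HX ?edge_valH.
by apply: (big_ind (fun x => x \in H)) => // f _; rewrite HX ?edge_valH.
Qed.

Lemma phi_delta e : phi (delta e) = edge_val e.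
Proof.
rewrite /phi -(big_pred1_eq *%g e edge_val) [RHS]big_mkcond.
by apply: eq_bigr => f _; rewrite ffunE; case: (f == e).
Qed.

Lemma phi0 : phi 0%R = 1.
Proof. by rewrite /phi big1 // => e _; rewrite ffunE expg0. Qed.

Lemma coset_run g w :
  foldl coset_next (coset_index g) w = coset_index (g * word_val w).
Proof.
elim: w g => [|s w IHw] g; first by rewrite /word_val big_nil mulg1.
by rewrite /= coset_next_index IHw /word_val big_cons mulgA.
Qed.

(** The Schreier generators along the path telescope, and [phi] may collect them by edge because H
    is abelian. The prefix [g] lets the induction start at any vertex. *)
Lemma word_val_edge_count g w :
  g * word_val w = g * transl (coset_index g) *
    phi (edge_count coset_next (coset_index g) w) *
    (transl (coset_index (g * word_val w)))^-1.
Proof.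
elim: w g => [|s w IHw] g; first by rewrite /word_val big_nil /= phi0 !mulg1 mulgK.
rewrite /word_val big_cons mulgA [LHS]IHw /= phiD phi_delta coset_next_index.
congr (_ * _); rewrite [RHS]mulgA; congr (_ * _).
by rewrite /edge_val /= coset_next_index !mulgA mulgK.
Qed.

Local Notation start := (coset_index 1).
Local Notation count := (edge_count coset_next start).
Local Notation run := (foldl coset_next start).

(** The value determines the coset where the path ends; once the ends agree, the outer translations
    cancel. *)
Lemma eq_word_val w w' :
  word_val w = word_val w' <-> run w = run w' /\ phi (count w) = phi (count w').
Proof.
have valE u : word_val u = transl start * phi (count u) * (transl (run u))^-1.
  by have := word_val_edge_count 1 u; rewrite coset_run !mul1g.
split=> [eqw|[eqr eqp]]; last by rewrite !valE eqr eqp.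
have eqr : run w = run w' by rewrite !coset_run eqw.
by split=> //; move: eqw; rewrite !valE eqr => /mulIg/mulgI.
Qed.

Definition edge_weight (v : {ffun I * S -> nat}) : nat := (\sum_e v e * omega e.2)%N.

Lemma edge_weightD : {morph edge_weight : u v / (u + v)%R}.
Proof.
move=> u v; rewrite natrDE -big_split; apply: eq_bigr => e _ /=.
by rewrite ffunE natrDE mulnDl.
Qed.

Lemma edge_weight_count i w : edge_weight (edge_count coset_next i w) = word_weight omega w.
Proof.
elim: w i => [|s w IHw] i.
  by rewrite /word_weight big_nil /edge_weight big1 // => e _; rewrite ffunE.
rewrite /= edge_weightD IHw /word_weight big_cons natrDE; congr (_ + _)%N.
rewrite /edge_weight (bigD1 (i, s)) //= ffunE eqxx mul1n big1 ?addn0 // => e e_neq.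
by rewrite ffunE (negbTE e_neq).
Qed.

Definition patterns (i : I) : seq (seq S) :=
  [seq b <- words S (#|I| * #|I| + #|I|) | run b == i].

Definition geodesic_count (i : I) (v : {ffun I * S -> nat}) : Prop :=
  forall b, b \in patterns i ->
    beats_all phi edge_weight (count b) (loops coset_next start b) v.

Lemma semilinear_geodesic_count i : semilinear (geodesic_count i).
Proof.
rewrite /geodesic_count; elim: (patterns i) => [|b bs IHbs].
  exact: semilinear_ext (semilinear_full _).
apply: semilinear_ext (semilinear_cap (semilinear_beats_all phiD edge_weightD
  (count b) (loops coset_next start b)) IHbs) => v.
split=> [[bv bsv] c|all_v]; first by rewrite inE => /orP[/eqP->|/bsv].
split=> [|c c_in]; apply: all_v; first exact: mem_head.
by rewrite inE c_in orbT.
Qed.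

(** Words with the value of [w] end in the same coset, and by [edge_count_paths] the linear sets of
    the patterns contain exactly the counts of words ending there. *)
Lemma geodesic_countE w : geodesic omega w <-> geodesic_count (run w) (count w).
Proof.
split=> [[_ minw] b b_in m lin_m phi_m|geo].
  have [|w' rw' cw'] := (edge_count_paths coset_next start (run w) m).2; first by exists b.
  rewrite -cw' !edge_weight_count; apply: minw; exists w' => //.
  by apply/eq_word_val; rewrite rw' cw'.
split; first by exists w.
move=> _ [w' /eq_word_val[rw' pw'] <-].
have [|b b_in lin_b] := (edge_count_paths coset_next start (run w) (count w')).1.
  by exists w'.
by have := geo b b_in _ lin_b pw'; rewrite !edge_weight_count.
Qed.

End VirtuallyAbelian.

Theorem theorem7p2 (G : groupType) (S : {fset G}) (omega : S -> nat)
  (hG : virtually_abelian G)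
  (omega_pos : forall s : S, 0 < omega s)
  (hS : generates_as_monoid S) :
  blind_multicounter (fun w : seq S => geodesic omega w).
Proof.
have [H [H_group H_abelian [T T_cover]]] := hG.
(* There are finitely many cosets, so semilinear descriptions can be chosen for all of them at
   once. *)
have [l lP] := fin_all_exists
  (semilinear_geodesic_count omega H_group H_abelian T_cover).
have [k [M MP]] := blind_multicounter_edge_count (coset_next H_group T_cover)
  (coset_index H_group T_cover 1%g) l.
by exists k, M => w; rewrite (geodesic_countE omega H_group H_abelian T_cover) lP -MP.
Qed.
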